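(* Let $n\ge 1$ be an integer and let $a,b,c\in\mathbb{R}$ with $ac>0$. Put $s=\sqrt{ac}$, $q=s/c$, $A_n=A_n(a,b,c)$, $S=A_n(s,b,s)$, $D=\operatorname{diag}(1,q,q^2,\dots,q^{n-1})$ and $W=D^{-2}$. Assume that $S$ is positive definite. Then $$\operatorname{cond}_{2,W}(A_n)=\operatorname{cond}_{2}(S)=\frac{b+2s\cos\left(\frac{\pi}{n+1}\right)}{b-2s\cos\left(\frac{\pi}{n+1}\right)}.$$
   Context: For $n\ge 1$ and $a,b,c\in\mathbb{R}$, $A_n(a,b,c)$ denotes the $n\times n$ tridiagonal Toeplitz matrix with all diagonal entries equal to $b$, all subdiagonal entries (positions $(i+1,i)$) equal to $a$, all superdiagonal entries (positions $(i,i+1)$) equal to $c$, and all other entries $0$. For a symmetric positive definite matrix $W$, put $\langle x,y\rangle_W=x^{T}Wy$ and $\|x\|_W=\sqrt{\langle x,x\rangle_W}$ for $x,y\in\mathbb{R}^n$; for $M\in\mathbb{R}^{n\times n}$, $\|M\|_{2,W}=\sup_{x\ne 0}\|Mx\|_W/\|x\|_W$, and for invertible $M$ the weighted condition number is $\operatorname{cond}_{2,W}(M)=\|M\|_{2,W}\,\|M^{-1}\|_{2,W}$. $\operatorname{cond}_2$ denotes the usual Euclidean (spectral norm) condition number, i.e. the case $W=I_n$. *)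

(* Defs.v *)
From mathcomp Require Import all_boot all_order all_algebra.
From mathcomp Require Import all_classical all_reals all_analysis.
Set Implicit Arguments.
Unset Strict Implicit.
Unset Printing Implicit Defensive.
Import Order.TTheory GRing.Theory Num.Theory.
Local Open Scope classical_set_scope.
Local Open Scope ring_scope.

Section WeightedCondition.
Variable R : realType.

Definition tritoeplitz (n : nat) (a b c : R) : 'M[R]_n :=
  \matrix_(i < n, j < n)
    if i == j then b
    else if i == j.+1 :> nat then a
    else if j == i.+1 :> nat then c
    else 0.

Definition wdot (n : nat) (W : 'M[R]_n) (x y : 'cV[R]_n) : R :=
  (x^T *m W *m y) 0 0.

Definition wnorm (n : nat) (W : 'M[R]_n) (x : 'cV[R]_n) : R :=
  Num.sqrt (wdot W x x).

Definition posdefmx (n : nat) (M : 'M[R]_n) : Prop :=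
  M^T = M /\ forall x : 'cV[R]_n, x != 0 -> 0 < wdot M x x.

(* [sup] is real-valued and defaults to 0 on sets without a supremum; when
   [0 < n] and [posdefmx W], the set below is nonempty and bounded. *)
Definition wopnorm (n : nat) (W M : 'M[R]_n) : R :=
  sup [set wnorm W (M *m x) / wnorm W x | x in [set x : 'cV[R]_n | x != 0]].

(* Meaningful for [M \in unitmx] only: [invmx M] is [M] otherwise. *)
Definition wcond (n : nat) (W M : 'M[R]_n) : R :=
  wopnorm W M * wopnorm W (invmx M).

Definition cond2 (n : nat) (M : 'M[R]_n) : R := wcond 1%:M M.

End WeightedCondition.

(* Main.v *)
Require Import Defs.
From mathcomp Require Import all_boot all_order all_algebra.
From mathcomp Require Import all_classical all_reals all_analysis.
From mathcomp Require Import ring lra.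
Set Implicit Arguments.
Unset Strict Implicit.
Unset Printing Implicit Defensive.
Import Order.TTheory GRing.Theory Num.Theory.
Local Open Scope ring_scope.

(** With [D = diag(q^i)] and [q = s / c], the matrix [A] is [D S D^-1], and the
    weight [W = D^-2] is the one for which [x |-> D x] is an isometry from the
    Euclidean norm to the [W]-norm. Hence [A] and its inverse have the same
    [W]-operator norms as [S] and its inverse have Euclidean ones
    ([wcond_similar]).

    For the Euclidean condition number of [S = b I + T], where [T] has zero
    diagonal and [s] next to it, the two extreme eigenvectors suffice. Put
    [t = pi / (n + 1)]. The recurrence
    [sin(k t) + sin((k + 2) t) = 2 cos t sin((k + 1) t)], together with
    [sin 0 = sin((n + 1) t) = 0], shows that the vector [sin(k t)], for
    [k = 1, ..., n], is an eigenvector of [T] for [2 s cos t], and that its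
    alternating version [(-1)^k sin(k t)] is one for [- 2 s cos t]. The former
    has positive entries and [T] is symmetric with nonnegative entries, so a
    Perron-Frobenius argument ([ge0_mx_form_le]) bounds the quadratic form of
    [T] by [2 s cos t |x|^2] in absolute value. Thus the form of [S] lies
    between [b - 2 s cos t] and [b + 2 s cos t] times [|x|^2], and both
    bounds are eigenvalues.

    Finally, for a symmetric positive definite matrix, bounds on the quadratic
    form become bounds on [|M x|] by the Cauchy-Schwarz inequality, so extreme
    eigenvalues that bound the form determine the condition number
    ([cond2_eigen]). *)

(** * Weighted inner products and their norms *)

Lemma invmx_mul (F : comUnitRingType) (n : nat) (P Q : 'M[F]_n) :
  P \in unitmx -> Q \in unitmx -> invmx (P *m Q) = invmx Q *m invmx P.
Proof.
move=> uP uQ; have uPQ : P *m Q \in unitmx by rewrite unitmx_mul uP.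
rewrite -[RHS](mulKmx uPQ) -(mulmxA P) (mulmxA Q) mulmxV // mul1mx mulmxV //.
by rewrite mulmx1.
Qed.

Section WeightedForms.
Variables (R : realType) (n : nat).
Implicit Types (W M P : 'M[R]_n) (u v x y z : 'cV[R]_n).

Lemma wdotDr W x y z : wdot W x (y + z) = wdot W x y + wdot W x z.
Proof. by rewrite /wdot mulmxDr !mxE. Qed.

Lemma wdotBl W x y z : wdot W (x - y) z = wdot W x z - wdot W y z.
Proof. by rewrite /wdot linearB /= !mulmxBl !mxE. Qed.

Lemma wdotBr W x y z : wdot W x (y - z) = wdot W x y - wdot W x z.
Proof. by rewrite /wdot mulmxBr !mxE. Qed.

Lemma wdotZl W k x y : wdot W (k *: x) y = k * wdot W x y.
Proof. by rewrite /wdot linearZ /= -!scalemxAl mxE. Qed.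

Lemma wdotZr W k x y : wdot W x (k *: y) = k * wdot W x y.
Proof. by rewrite /wdot -scalemxAr mxE. Qed.

Lemma wdotC W x y : W^T = W -> wdot W x y = wdot W y x.
Proof.
move=> symW; have trE (N : 'M[R]_1) : N 0 0 = N^T 0 0 by rewrite mxE.
by rewrite /wdot trE !trmx_mul trmxK symW mulmxA.
Qed.

Lemma wdotE W x y : wdot W x y = wdot 1%:M x (W *m y).
Proof. by rewrite /wdot mulmx1 mulmxA. Qed.

Lemma wdot1E x y : wdot 1%:M x y = \sum_i x i 0 * y i 0.
Proof. by rewrite /wdot mulmx1 mxE; apply: eq_bigr => i _; rewrite mxE. Qed.

Lemma wdot_sumE W x y :
  wdot W x y = \sum_i \sum_j W i j * (x i 0 * y j 0).
Proof.
rewrite wdotE wdot1E; apply: eq_bigr => i _; rewrite mxE mulr_sumr.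
by apply: eq_bigr => j _; rewrite mulrCA.
Qed.

Lemma posdefmx1 : posdefmx (1%:M : 'M[R]_n).
Proof.
split=> [|x x_neq0]; first exact: trmx1.
rewrite wdot1E lt0r sumr_ge0 ?andbT; last by move=> i _; rewrite -expr2 sqr_ge0.
apply: contra_neq x_neq0 => /eqP.
rewrite psumr_eq0 => [/allP x0|i _]; last by rewrite -expr2 sqr_ge0.
apply/matrixP => i j; rewrite ord1 mxE.
by have := x0 i (mem_index_enum i); rewrite mulf_eq0 orbb => /eqP.
Qed.

Lemma wdot_ge0 W x : posdefmx W -> 0 <= wdot W x x.
Proof.
case=> _ posW; have [->|/posW/ltW //] := eqVneq x 0.
by rewrite /wdot mulmx0 mxE.
Qed.

Lemma wdot_CauchySchwarz W x y :
  posdefmx W -> wdot W x y ^+ 2 <= wdot W x x * wdot W y y.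
Proof.
move=> posW; have [->|/posW.2 y_gt0] := eqVneq y 0.
  by rewrite /wdot !mulmx0 mxE expr0n mulr0.
(* The component of [x] orthogonal to [y], scaled to avoid a division. *)
set z := wdot W y y *: x - wdot W x y *: y.
have := wdot_ge0 z posW.
rewrite wdotBl !wdotBr !wdotZl !wdotZr (wdotC y x posW.1).
set p := wdot W x y; set r := wdot W y y; set t := wdot W x x => z_ge0.
rewrite -subr_ge0 -(pmulr_rge0 _ y_gt0) -/r.
suff -> : r * (t * r - p ^+ 2) =
   r * (r * t) - p * (r * p) - (r * (p * p) - p * (p * r)) by lra.
ring.
Qed.

Lemma wnorm0 W : wnorm W 0 = 0.
Proof. by rewrite /wnorm /wdot mulmx0 mxE sqrtr0. Qed.

Lemma wnorm_gt0 W x : posdefmx W -> x != 0 -> 0 < wnorm W x.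
Proof. by move=> posW /posW.2; rewrite sqrtr_gt0. Qed.

Lemma posdefmx_unit W : posdefmx W -> W \in unitmx.
Proof.
case=> symW posW; rewrite unitmxE unitfE; apply/det0P => -[v v_neq0 vW0].
have /posW : v^T != 0 by rewrite -(inj_eq (@trmx_inj _ _ _)) trmxK trmx0.
by rewrite /wdot trmxK vW0 mul0mx mxE ltxx.
Qed.

(** * Operator norms and condition numbers *)

Lemma wopnorm_attained W M k v : posdefmx W -> v != 0 ->
  (forall x, wnorm W (M *m x) <= k * wnorm W x) ->
  wnorm W (M *m v) = k * wnorm W v -> wopnorm W M = k.
Proof.
move=> posW v_neq0 Mle Mv; rewrite /wopnorm.
apply/eqP; rewrite eq_le; apply/andP; split.
  apply: ge_sup; first by exists (wnorm W (M *m v) / wnorm W v); exists v.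
  by move=> _ [x x_neq0 <-]; rewrite ler_pdivrMr ?wnorm_gt0.
apply: ub_le_sup.
  by exists k => _ [x x_neq0 <-]; rewrite ler_pdivrMr ?wnorm_gt0.
by exists v => //; rewrite Mv mulfK ?gt_eqF ?wnorm_gt0.
Qed.

Lemma wnormZ W k x : 0 <= k -> wnorm W (k *: x) = k * wnorm W x.
Proof.
move=> k_ge0; rewrite /wnorm wdotZl wdotZr mulrA -expr2.
by rewrite sqrtrM ?sqr_ge0 // sqrtr_sqr ger0_norm.
Qed.

Lemma wnorm_sqr W x : posdefmx W -> wnorm W x ^+ 2 = wdot W x x.
Proof. by move=> posW; rewrite sqr_sqrtr ?wdot_ge0. Qed.

Lemma wdot_le_wnorm W x y : posdefmx W -> wdot W x y <= wnorm W x * wnorm W y.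
Proof.
move=> posW; apply: le_trans (ler_norm _) _.
rewrite -sqrtrM ?wdot_ge0 // -sqrtr_sqr ler_wsqrtr //.
exact: wdot_CauchySchwarz.
Qed.

(** With [y = M x], the Cauchy-Schwarz inequality for the inner product of [M]
    itself gives [|y|^2 = <y, x>_M <= |y|_M |x|_M <= k |y| |x|]. The
    Euclidean inequality alone would only yield lower bounds on [|M x|]. *)
Lemma wnorm_mul_le M k x : posdefmx M -> 0 <= k ->
  (forall y, wdot M y y <= k * wdot 1%:M y y) ->
  wnorm 1%:M (M *m x) <= k * wnorm 1%:M x.
Proof.
move=> posM k_ge0 Mle; set y := M *m x; have pos1 := posdefmx1.
have [->|/(wnorm_gt0 pos1) y_gt0] := eqVneq y 0.
  by rewrite wnorm0 mulr_ge0 // sqrtr_ge0.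
have wM z : wnorm M z <= Num.sqrt k * wnorm 1%:M z.
  by rewrite -sqrtrM // ler_wsqrtr.
rewrite -(ler_pM2l y_gt0) -expr2 wnorm_sqr // -wdotE.
apply: le_trans (wdot_le_wnorm y x posM) _.
rewrite -[k in leRHS](sqr_sqrtr k_ge0).
have := ler_pM (sqrtr_ge0 _) (sqrtr_ge0 _) (wM y) (wM x).
by rewrite -/(wnorm M y) -/(wnorm M x) => /le_trans -> //; lra.
Qed.

(** Here [k |x|^2 <= <x, M x> <= |x| |M x|]. *)
Lemma wnorm_mul_ge M k x :
  (forall y, k * wdot 1%:M y y <= wdot M y y) ->
  k * wnorm 1%:M x <= wnorm 1%:M (M *m x).
Proof.
move=> Mge; have pos1 := posdefmx1.
have [->|/(wnorm_gt0 pos1) x_gt0] := eqVneq x 0.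
  by rewrite mulmx0 wnorm0 mulr0.
rewrite -(ler_pM2l x_gt0) mulrCA -expr2 wnorm_sqr //.
apply: le_trans (Mge x) _; by rewrite wdotE; apply: wdot_le_wnorm.
Qed.

Lemma posdefmx_eigen_gt0 M k v :
  posdefmx M -> v != 0 -> M *m v = k *: v -> 0 < k.
Proof.
move=> posM v_neq0 Mv; have := posM.2 _ v_neq0; rewrite wdotE Mv wdotZr.
by rewrite pmulr_lgt0 //; have [_] := posdefmx1; apply.
Qed.

(** Eigenvalues that bound the quadratic form are the extreme ones, so [|M|]
    is [hi], attained at [v], and [|M^-1|] is [1 / lo], attained at [u]. *)
Lemma cond2_eigen M lo hi u v : posdefmx M ->
  u != 0 -> M *m u = lo *: u -> v != 0 -> M *m v = hi *: v ->
  (forall x, lo * wdot 1%:M x x <= wdot M x x <= hi * wdot 1%:M x x) ->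
  cond2 M = hi / lo.
Proof.
move=> posM u_neq0 Mu v_neq0 Mv Mform; have pos1 := posdefmx1.
have lo_gt0 := posdefmx_eigen_gt0 posM u_neq0 Mu.
have hi_gt0 := posdefmx_eigen_gt0 posM v_neq0 Mv.
have uM := posdefmx_unit posM.
rewrite /cond2 /wcond; congr (_ * _).
  apply: (wopnorm_attained pos1 v_neq0) => [x|]; last by rewrite Mv wnormZ ?ltW.
  by apply: (wnorm_mul_le _ posM (ltW hi_gt0)) => y; case/andP: (Mform y).
apply: (wopnorm_attained pos1 u_neq0) => [x|].
  rewrite ler_pdivlMl // -{2}(mulKVmx uM x).
  by apply: wnorm_mul_ge => y; case/andP: (Mform y).
have Miu : invmx M *m u = lo^-1 *: u.
  by rewrite -{2}(mulKmx uM u) Mu -scalemxAr scalerA mulVf ?scale1r // gt_eqF.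
by rewrite Miu wnormZ // invr_ge0 ltW.
Qed.

(** The easy half of the Perron-Frobenius theorem, by the Schur test: for
    positive [v], the inequality of arithmetic and geometric means gives
    [2 |x_i x_j| <= (v_j / v_i) x_i^2 + (v_i / v_j) x_j^2]. Weighted by [M i j]
    and summed, both terms on the right give the same total by symmetry, and
    the eigenvalue equation collapses it to [k |x|^2]. *)
Lemma ge0_mx_form_le M k v : M^T = M -> (forall i j, 0 <= M i j) ->
  (forall i, 0 < v i 0) -> M *m v = k *: v ->
  forall x, `|wdot M x x| <= k * wdot 1%:M x x.
Proof.
move=> symM M_ge0 v_gt0 Mv x.
have MC i j : M i j = M j i by rewrite -{1}symM mxE.
pose F i j := M i j * (v j 0 / v i 0 * x i 0 ^+ 2).
have sumF : \sum_i \sum_j F i j = k * wdot 1%:M x x.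
  rewrite wdot1E mulr_sumr; apply: eq_bigr => i _.
  have := congr1 (fun w : 'cV[R]_n => w i 0) Mv; rewrite !mxE => Mvi.
  transitivity ((\sum_j M i j * v j 0) / v i 0 * x i 0 ^+ 2).
    by rewrite !mulr_suml; apply: eq_bigr => j _; rewrite /F !mulrA.
  by rewrite Mvi mulfK ?gt_eqF // expr2.
have -> : k * wdot 1%:M x x = \sum_i \sum_j (F i j + F j i) / 2.
  rewrite -sumF; under [RHS]eq_bigr do rewrite -mulr_suml big_split /=.
  by rewrite -mulr_suml big_split /= [X in _ + X]exchange_big /=; lra.
rewrite wdot_sumE; apply: le_trans (ler_norm_sum _ _ _) _.
apply: ler_sum => i _; apply: le_trans (ler_norm_sum _ _ _) _.
apply: ler_sum => j _; rewrite /F (MC j i) normrM ger0_norm //.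
rewrite -mulrDr -mulrA; apply: ler_wpM2l => //.
have vi := v_gt0 i; have vj := v_gt0 j.
pose r := v j 0 / v i 0; have r_gt0 : 0 < r by rewrite divr_gt0.
have -> : v i 0 / v j 0 = r^-1 by rewrite invf_div.
rewrite -/r normrM ler_pdivlMr // -subr_ge0.
have -> : r * x i 0 ^+ 2 + r^-1 * x j 0 ^+ 2 - `|x i 0| * `|x j 0| * 2 =
    r^-1 * (r * `|x i 0| - `|x j 0|) ^+ 2.
  rewrite -(real_normK (num_real (x i 0))) -(real_normK (num_real (x j 0))).
  by field; rewrite gt_eqF.
by rewrite mulr_ge0 ?sqr_ge0 // invr_ge0 ltW.
Qed.

(** The weight [(P P^T)^-1] is the one that makes [x |-> P x] an isometry from
    the Euclidean norm to the weighted one. *)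
Lemma wcond_similar P M : P \in unitmx -> M \in unitmx ->
  wcond (invmx (P *m P^T)) (P *m M *m invmx P) = cond2 M.
Proof.
move=> uP uM; have uPt : P^T \in unitmx by rewrite unitmx_tr.
have wnormP x : wnorm (invmx (P *m P^T)) (P *m x) = wnorm 1%:M x.
  rewrite /wnorm /wdot invmx_mul // trmx_mul !mulmxA.
  by rewrite mulmxKV // mulmxK // mulmx1.
have wopnormP N :
    wopnorm (invmx (P *m P^T)) (P *m N *m invmx P) = wopnorm 1%:M N.
  rewrite /wopnorm; congr sup; apply/seteqP; split=> r /= -[x x_neq0 <-].
    exists (invmx P *m x); last by rewrite -!wnormP !mulmxA mulmxV // mul1mx.
    by apply: contra_neq x_neq0 => x0; rewrite -(mulKVmx uP x) x0 mulmx0.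
  exists (P *m x).
    by apply: contra_neq x_neq0 => x0; rewrite -(mulKmx uP x) x0 mulmx0.
  by rewrite -(mulmxA _ (invmx P)) mulKmx // -mulmxA !wnormP.
rewrite /wcond; have -> : invmx (P *m M *m invmx P) = P *m invmx M *m invmx P.
  by rewrite !invmx_mul ?unitmx_mul ?unitmx_inv ?uP ?uM // invmxK mulmxA.
by rewrite /wcond !wopnormP.
Qed.

End WeightedForms.

(** * Tridiagonal Toeplitz matrices *)

Section ToeplitzSpectrum.
Variable R : realType.

(** Numbering the entries of the vector from [1] lets the two vanishing values
    [f 0] and [f n.+1] stand for the neighbours that the first and the last
    row lack, so the same three-term formula holds in every row. *)
Lemma tritoeplitz_mul n (a b c : R) (f : nat -> R) (i : 'I_n) :
  f 0%N = 0 -> f n.+1 = 0 ->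
  (tritoeplitz n a b c *m \col_(j < n) f j.+1) i 0 =
  a * f i + b * f i.+1 + c * f i.+2.
Proof.
move=> f0 fn; rewrite mxE.
have sum_at (k : R) (m : nat) :
    \sum_(j < n | j.+1 == m) k * f j.+1 = k * (if (m <= n)%N then f m else 0).
  case: m => [|m]; first by rewrite big_pred0 // f0 mulr0.
  case: ltnP => mn; last first.
    rewrite big_pred0 ?mulr0 // => j; apply/negbTE.
    by rewrite eqSS neq_ltn (leq_trans (ltn_ord j) mn).
  by rewrite (big_pred1 (Ordinal mn)).
transitivity (\sum_(j < n | j.+1 == i) a * f j.+1 +
  \sum_(j < n | j.+1 == i.+1) b * f j.+1 +
  \sum_(j < n | j.+1 == i.+2) c * f j.+1).
  rewrite [X in X + _ + _]big_mkcond [X in _ + X + _]big_mkcond.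
  rewrite [X in _ + _ + X]big_mkcond -!big_split /=.
  apply: eq_bigr => j _; rewrite !mxE !eqSS -val_eqE /=.
  rewrite [(i : nat) == j.+1]eq_sym [(j : nat) == i]eq_sym.
  case: (ltngtP i j) => [ij|ji|->].
  - rewrite (gtn_eqF (leq_trans ij (leqnSn j))) !add0r.
    by case: (_ == _); rewrite ?mul0r.
  - rewrite (ltn_eqF (leq_trans ji (leqnSn i))) !addr0.
    by case: (_ == _); rewrite ?mul0r.
  - by rewrite (gtn_eqF (ltnSn j)) (ltn_eqF (ltnSn j)) add0r addr0.
rewrite !sum_at // ltn_ord (ltnW (ltn_ord i)).
(* In the last row [i.+2 = n.+1], where [f] vanishes. *)
congr (_ + _ * _); case: ltnP => // ni.
by rewrite (_ : i.+2 = n.+1) ?fn //; apply/eqP; rewrite eqn_leq ltnS ltn_ord.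
Qed.

Lemma tritoeplitz_tr n (a b c : R) :
  (tritoeplitz n a b c)^T = tritoeplitz n c b a.
Proof.
apply/matrixP => i j; rewrite !mxE (eq_sym j i).
case: eqVneq => // _.
case: eqP => [->|_]; last by case: eqP.
by rewrite (ltn_eqF (leqnSn _)).
Qed.

Lemma tritoeplitz_diag n (a b c : R) :
  tritoeplitz n a b c = b%:M + tritoeplitz n a 0 c.
Proof.
by apply/matrixP => i j; rewrite !mxE; case: eqP => _; rewrite ?addr0 ?add0r.
Qed.

(** Conjugation by a geometric diagonal multiplies one off-diagonal by [q] and
    divides the other one by [q]; the hypothesis makes the two meet. *)
Lemma tritoeplitz_similar n (a b c q : R) : c * q ^+ 2 = a ->
  let D := diag_mx (\row_(i < n) q ^+ i) in
  tritoeplitz n a b c *m D = D *m tritoeplitz n (c * q) b (c * q).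
Proof.
move=> <- D; apply/matrixP => i j.
rewrite /D mul_mx_diag mul_diag_mx !mxE.
case: eqVneq => [->|_]; first by rewrite mulrC.
case: eqP => [->|_]; first by rewrite [q ^+ j.+1]exprS; ring.
by case: eqP => [->|_]; rewrite ?mul0r ?mulr0 // [q ^+ i.+1]exprS; ring.
Qed.

Lemma sin_recurrence (t : R) k :
  sin (k%:R * t) + sin (k.+2%:R * t) = 2 * cos t * sin (k.+1%:R * t).
Proof.
have -> : k%:R * t = k.+1%:R * t - t by rewrite -[k.+1]addn1 natrD; ring.
have -> : k.+2%:R * t = k.+1%:R * t + t by rewrite -[k.+2]addn1 natrD; ring.
by rewrite sinB sinD; ring.
Qed.

(** The two sine vectors are eigenvectors for the claimed extreme eigenvalues;
    positivity of the first one bounds the quadratic form of the off-diagonal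
    part from both sides at once. *)
Lemma cond2_sym_tritoeplitz n (b s : R) : (0 < n)%N -> 0 <= s ->
  posdefmx (tritoeplitz n s b s) ->
  cond2 (tritoeplitz n s b s) =
  (b + 2 * s * cos (pi / n.+1%:R)) / (b - 2 * s * cos (pi / n.+1%:R)).
Proof.
case: n => // n _ s_ge0; set t : R := pi / _.
set S := tritoeplitz _ _ _ _ => posS.
have nt : n.+2%:R * t = pi by rewrite mulrC divfK.
have sin_end : sin (n.+2%:R * t) = 0 by rewrite nt sinpi.
have sin_start : sin (0%:R * t) = 0 by rewrite mul0r sin0.
have sin_gt0 (i : 'I_n.+1) : 0 < sin (i.+1%:R * t).
  have t_gt0 : 0 < t by rewrite divr_gt0 ?pi_gt0.
  rewrite sin_gt0_pi // mulr_gt0 //= -nt ltr_pM2r // ltr_nat ltnS.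
  exact: ltn_ord.
pose v : 'cV[R]_n.+1 := \col_i sin (i.+1%:R * t).
pose u : 'cV[R]_n.+1 := \col_i ((-1) ^+ i.+1 * sin (i.+1%:R * t)).
(* The diagonal [d] is [b] for [S] and [0] for its off-diagonal part. *)
have eigen_v d : tritoeplitz n.+1 s d s *m v = (d + 2 * s * cos t) *: v.
  apply/matrixP => i j; rewrite ord1.
  rewrite (tritoeplitz_mul _ _ _ (f := fun k => sin (k%:R * t))) //.
  rewrite !mxE addrAC -mulrDr sin_recurrence; ring.
have eigen_u : S *m u = (b - 2 * s * cos t) *: u.
  apply/matrixP => i j; rewrite ord1.
  pose f k : R := (-1) ^+ k * sin (k%:R * t).
  rewrite (tritoeplitz_mul _ _ _ (f := f)) /f ?sin_start ?sin_end ?mulr0 //.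
  rewrite !mxE !exprS.
  have -> : sin (i.+2%:R * t) = 2 * cos t * sin (i.+1%:R * t) - sin (i%:R * t).
    by rewrite -sin_recurrence; ring.
  ring.
have v_neq0 : v != 0.
  by apply/eqP => /matrixP/(_ 0 0); rewrite !mxE; apply/eqP; rewrite gt_eqF.
have u_neq0 : u != 0.
  apply/eqP => /matrixP/(_ 0 0); rewrite !mxE; apply/eqP.
  by rewrite mulf_neq0 ?signr_eq0 // gt_eqF.
apply: (cond2_eigen posS u_neq0 eigen_u v_neq0 (eigen_v b)) => x.
have M_ge0 i j : 0 <= tritoeplitz n.+1 s 0 s i j.
  by rewrite mxE; do 3![case: ifP => // _].
have v_gt0 i : 0 < v i 0 by rewrite mxE.
have := ge0_mx_form_le (tritoeplitz_tr _ _ _ _) M_ge0 v_gt0 (eigen_v 0) x.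
rewrite [wdot S x x]wdotE /S (tritoeplitz_diag n.+1 s b s).
rewrite mulmxDl mul_scalar_mx wdotDr wdotZr -wdotE ler_norml.
set p := wdot 1%:M x x; set r := wdot _ x x.
by move=> /andP[r_ge r_le]; apply/andP; split; lra.
Qed.

End ToeplitzSpectrum.

Theorem corollary5p3 (R : realType) (n : nat) (a b c : R)
    (n_ge1 : (1 <= n)%N) (ac_gt0 : 0 < a * c) :
  let s : R := Num.sqrt (a * c) in
  let q : R := s / c in
  let A : 'M[R]_n := tritoeplitz n a b c in
  let S : 'M[R]_n := tritoeplitz n s b s in
  let D : 'M[R]_n := diag_mx (\row_(i < n) q ^+ i) in
  let W : 'M[R]_n := invmx (D *m D) in
  posdefmx S ->
  wcond W A = cond2 S /\
  cond2 S = (b + 2 * s * cos (pi / n.+1%:R)) / (b - 2 * s * cos (pi / n.+1%:R)).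
Proof.
move=> s q A S D W posS; split; last first.
  exact: (cond2_sym_tritoeplitz n_ge1 (sqrtr_ge0 _) posS).
have s_gt0 : 0 < s by rewrite sqrtr_gt0.
have c_neq0 : c != 0 by apply: contraTneq ac_gt0 => ->; rewrite mulr0 ltxx.
have q_neq0 : q != 0 by rewrite mulf_neq0 ?invr_eq0 // gt_eqF.
have uD : D \in unitmx.
  rewrite unitmxE det_diag unitfE prodf_seq_neq0.
  by apply/allP => i _; rewrite mxE expf_neq0.
have s_cq : c * q = s by rewrite mulrC divfK.
have a_cq : c * q ^+ 2 = a.
  rewrite expr2 mulrA s_cq mulrA -expr2 sqr_sqrtr ?ltW //.
  by rewrite mulfK.
have AD : A = D *m S *m invmx D.
  by rewrite /S -s_cq -(tritoeplitz_similar n b a_cq) mulmxK.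
rewrite /W -[X in _ *m X]tr_diag_mx AD.
exact: wcond_similar uD (posdefmx_unit posS).
Qed.
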